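(* Let $\alpha_1,\dots,\alpha_6$ be complex numbers with $\sum_{k=1}^{6}\alpha_k\neq 0$. Let $\mathcal{A}$ and $\mathcal{B}$ be two unital complex $\ast$-algebras with multiplicative identities $1_{\mathcal{A}}$ and $1_{\mathcal{B}}$, respectively, such that $\mathcal{A}$ is prime and has a nontrivial projection. Let $\Phi:\mathcal{A}\rightarrow\mathcal{B}$ be a bijective mapping (not assumed additive or linear) that preserves the sum of triple products $\alpha_1 ab^{*}c+\alpha_2 acb^{*}+\alpha_3 b^{*}ac+\alpha_4 cab^{*}+\alpha_5 b^{*}ca+\alpha_6 cb^{*}a$, i.e. $$\begin{aligned}&\Phi(\alpha_1 ab^{*}c+\alpha_2 acb^{*}+\alpha_3 b^{*}ac+\alpha_4 cab^{*}+\alpha_5 b^{*}ca+\alpha_6 cb^{*}a)\\ &=\alpha_1\Phi(a)\Phi(b)^{*}\Phi(c)+\alpha_2\Phi(a)\Phi(c)\Phi(b)^{*}+\alpha_3\Phi(b)^{*}\Phi(a)\Phi(c)\\ &\quad+\alpha_4\Phi(c)\Phi(a)\Phi(b)^{*}+\alpha_5\Phi(b)^{*}\Phi(c)\Phi(a)+\alpha_6\Phi(c)\Phi(b)^{*}\Phi(a)\end{aligned}$$ for all $a,b,c\in\mathcal{A}$. Then $\Phi$ is additive. In addition: (i) if $\Phi(1_{\mathcal{A}})$ is a projection of $\mathcal{B}$, then $\Phi$ is a $\ast$-Jordan ring isomorphism; (ii) if $\mathcal{B}$ is prime and $\Phi(1_{\mathcal{A}})$ is a projection of $\mathcal{B}$,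 then $\Phi$ is either a $\ast$-ring isomorphism or a $\ast$-ring anti-isomorphism.
   Context: A complex $\ast$-algebra is an associative complex algebra with a conjugate-linear involution $\ast$ satisfying $(ab)^*=b^*a^*$. A projection is an element $p$ with $p=p^*=p^2$; it is nontrivial if $p\neq 0$ and $p\neq 1$. An algebra is prime if $a\mathcal{A}b=\{0\}$ implies $a=0$ or $b=0$. A $\ast$-Jordan ring isomorphism is an additive bijection $\Phi$ with $\Phi(ac+ca)=\Phi(a)\Phi(c)+\Phi(c)\Phi(a)$ and $\Phi(a^* )=\Phi(a)^*$ for all $a,c$. A $\ast$-ring isomorphism (resp. $\ast$-ring anti-isomorphism) is an additive bijection $\Phi$ with $\Phi(a^* )=\Phi(a)^*$ and $\Phi(ac)=\Phi(a)\Phi(c)$ (resp. $\Phi(ac)=\Phi(c)\Phi(a)$) for all $a,c$; complex linearity is not required. *)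

(* Defs.v *)
From HB Require Import structures.
From mathcomp Require Import all_boot all_order all_algebra.
From mathcomp Require Import complex.
From mathcomp Require Import reals.

Set Implicit Arguments.
Unset Strict Implicit.
Unset Printing Implicit Defensive.

Import GRing.Theory.

Local Open Scope ring_scope.
Local Open Scope complex_scope.

(* The complex numbers are R[i] for an arbitrary model R : realType of the
   real numbers, and [conjc] is complex conjugation. An [algType] is unital
   with 1 <> 0, which loses nothing for an algebra with a projection p <> 0,
   nor for one that is in bijection with it. *)
HB.mixin Record Algebra_isStarAlgebra (R : realType) A
    of GRing.Algebra R[i] A := {
  star : A -> A;
  star_conj_linear : forall (k : R[i]) (a b : A),
    star (k *: a + b) = conjc k *: star a + star b;
  starM : forall a b : A, star (a * b) = star b * star a;
  starK : involutive star
}.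

#[short(type="starAlgType")]
HB.structure Definition StarAlgebra (R : realType) :=
  {A of GRing.Algebra R[i] A & Algebra_isStarAlgebra R A}.

Bind Scope ring_scope with StarAlgebra.sort.

Definition projection (R : realType) (A : starAlgType R) (p : A) : Prop :=
  p = star p /\ p = p ^+ 2.

Definition nontrivial_projection (R : realType) (A : starAlgType R)
    (p : A) : Prop :=
  [/\ projection p, p <> 0 & p <> 1].

Definition prime_algebra (R : realType) (A : algType R[i]) : Prop :=
  forall a b : A, (forall x : A, a * x * b = 0) -> a = 0 \/ b = 0.

(* None of the maps below is required to be complex linear. *)
Section Maps.
Context (R : realType) (A B : starAlgType R).
Implicit Type Phi : A -> B.

Definition additive_map Phi : Prop :=
  {morph Phi : a b / a + b >-> a + b}.

Definition star_preserving Phi : Prop :=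
  {morph Phi : a / star a >-> star a}.

Definition star_jordan_ring_isomorphism Phi : Prop :=
  [/\ bijective Phi, additive_map Phi,
      forall a c, Phi (a * c + c * a) = Phi a * Phi c + Phi c * Phi a
    & star_preserving Phi].

Definition star_ring_isomorphism Phi : Prop :=
  [/\ bijective Phi, additive_map Phi, star_preserving Phi
    & forall a c, Phi (a * c) = Phi a * Phi c].

Definition star_ring_anti_isomorphism Phi : Prop :=
  [/\ bijective Phi, additive_map Phi, star_preserving Phi
    & forall a c, Phi (a * c) = Phi c * Phi a].

End Maps.

(* Main.v *)
Require Import Defs.
From mathcomp Require Import all_boot all_order all_algebra.
From mathcomp Require Import complex.
From mathcomp Require Import reals.
From mathcomp Require Import boolp.
From Stdlib Require Import Ncring Ncring_tac.

Import GRing.Theory.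
Local Open Scope ring_scope.
Local Open Scope complex_scope.

(** Putting the identity in the middle slot turns the triple product into a
    twisted Jordan product [beta xz + gamma zx], where [beta] and [gamma] are
    the sums of the first and of the last three coefficients.  Since [Phi 1]
    may be anything, [Phi] does not preserve this product; but it carries it to
    some biadditive operation of [B], and this is enough for additivity.

    Additivity ([twisted_jordan_additive]).  After exchanging the two factors
    if necessary, [beta] and [beta + gamma] are both nonzero.  Given [x] and
    [y], surjectivity provides [t] with [Phi t = Phi x + Phi y], and the claim
    is that the defect [D = t - (x + y)] vanishes.  If [Phi] is already known
    to be additive on the products of [x] and [y] with [z], taken on one side,
    then injectivity makes the product of [D] with [z] vanish on that side.
    If this holds on both sides, then [Dz + zD = 0], as [beta + gamma] is
    nonzero.  Taking for [z] a Peirce idempotent, or an off-diagonal element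
    for the projection [p], kills [D] corner by corner, primeness of [A] being
    what makes off-diagonal multiplication faithful.  The order in which the
    corners are treated is: one diagonal with one off-diagonal term, the two
    off-diagonal terms, one diagonal with both, all four, and finally two terms
    in the same corner.  The off-diagonal case of that last step comes from
    [(e + a)(f + b) = a + b] for [a], [b] in [eAf] and [f = 1 - e].

    Jordan property.  Let [q = Phi 1] be a projection, and let [s] be the sum
    of the six coefficients.  Then [Phi (s a)] is the triple product of [Phi a],
    [q], [q], in which every monomial begins or ends with [q]; so
    [(1 - q) B (1 - q) = 0] by surjectivity, and [q = 1].  The triple product
    with two entries equal to 1 now shows that [Phi] commutes with the scalar
    [s] and with the involution, and symmetrising the twisted Jordan product
    gives [Phi (ac + ca) = Phi a Phi c + Phi c Phi a].

    Dichotomy ([jordan_hom_or_antihom], due to Herstein and Smiley).  For a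
    Jordan homomorphism [f] onto a prime ring without 2-torsion, put
    [X = f (ab) - f a f b] and [Y = f (ab) - f b f a].  Computing the image of
    [abcba + bacab] in two ways gives [X f(c) Y + Y f(c) X = 0], hence [X = 0]
    or [Y = 0].  An additive group is not the union of two proper subgroups, so
    the same alternative holds for all [b] when [a] is fixed, and then for all
    [a]. *)

(** * Normalisation in noncommutative rings *)

Section NoncommutativeRing.
Variable A : pzRingType.

#[local] Instance ncring_ops :
  @Ring_ops A 0 1 +%R *%R (fun x y => x - y) -%R eq := {}.

#[local] Instance ncring_laws : Ring (Ro := ncring_ops).
Proof.
split.
- exact: eq_equivalence.
- by move=> ? ? -> ? ? ->.
- by move=> ? ? -> ? ? ->.
- by move=> ? ? -> ? ? ->.
- by move=> ? ? ->.
- by move=> x; apply: (add0r x).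
- by move=> x y; apply: (addrC x y).
- by move=> x y z; apply: (addrA x y z).
- by move=> x; apply: (mul1r x).
- by move=> x; apply: (mulr1 x).
- by move=> x y z; apply: (mulrA x y z).
- by move=> x y z; apply: (mulrDl x y z).
- by move=> x y z; apply: (mulrDr z x y).
- by [].
- by move=> x; apply: (subrr x).
Qed.

(** With [d] in the role of [f (ab)], the left-hand side is the expression
    [XcY + YcX] of Smiley's argument, and the right-hand side compares the two
    ways of computing the image of [abcba + bacab]. *)
Lemma mul_sub_sub_anticomm (a b d c : A) :
  (d - a * b) * c * (d - b * a) + (d - b * a) * c * (d - a * b)
  = (a * (b * c * b) * a + b * (a * c * a) * b)
    - (d * c * (a * b + b * a - d) + (a * b + b * a - d) * c * d).
Proof. non_commutative_ring. Qed.

Lemma jordan_triple_expand (a b : A) :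
  a * (a * b + b * a) + (a * b + b * a) * a
  = (a * b * a + a * b * a) + (a * a * b + b * (a * a)).
Proof. non_commutative_ring. Qed.

Lemma jordan_triple_polar (a b c : A) :
  (a + c) * b * (a + c) = a * b * a + c * b * c + (a * b * c + c * b * a).
Proof. non_commutative_ring. Qed.

End NoncommutativeRing.

(** * Jordan homomorphisms onto prime rings *)

Section Prime.
Variable A : pzRingType.

Definition prime_ring : Prop :=
  forall a b : A, (forall x, a * x * b = 0) -> a = 0 \/ b = 0.

Definition two_torsion_free : Prop := forall x : A, x + x = 0 -> x = 0.

(** The hypothesis lets the outer [x] and [y] of a word be exchanged at the
    price of a sign.  Applied to the first factor of [(xcy) d (xcy)] it gives
    [- yc x(dxc)y]; applied to the whole word and then to [y(dxc)x] it gives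
    [yc x(dxc)y].  Hence [xcy A xcy = 0], and primeness applies twice. *)
Lemma prime_anticomm_eq0 (x y : A) :
  prime_ring -> two_torsion_free ->
  (forall c, x * c * y + y * c * x = 0) -> x = 0 \/ y = 0.
Proof.
move=> pA tA xy0.
have swap c : x * c * y = - (y * c * x).
  by apply/eqP; rewrite -addr_eq0 xy0.
apply: (pA) => c.
suff: x * c * y = 0 \/ x * c * y = 0 by case.
apply: (pA) => d; apply: tA.
have e1 : x * c * y * d * (x * c * y) = - (y * c * (x * (d * x * c) * y)).
  by rewrite {1}swap !mulNr !mulrA.
have e2 : x * c * y * d * (x * c * y) = y * c * (x * (d * x * c) * y).
  have -> : x * c * y * d * (x * c * y) = x * (c * y * d * x * c) * y.
    by rewrite !mulrA.
  rewrite swap.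
  have -> : y * (c * y * d * x * c) * x = y * c * (y * (d * x * c) * x).
    by rewrite !mulrA.
  by rewrite [in RHS]swap mulrN.
by rewrite {1}e1 e2 addNr.
Qed.

End Prime.

(** A group is not the union of two proper subgroups. *)
Lemma additive_cover (A : zmodType) (P Q : A -> Prop) :
  (forall x y, P x -> P (x + y) -> P y) ->
  (forall x y, Q x -> Q (x + y) -> Q y) ->
  (forall x, P x \/ Q x) -> (forall x, P x) \/ (forall x, Q x).
Proof.
move=> PD QD PQ.
have [allP|/existsNP[x nPx]] := pselect (forall x, P x); first by left.
have [allQ|/existsNP[y nQy]] := pselect (forall x, Q x); first by right.
have [|Qx] := PQ x; first by [].
have [Py|] := PQ y; last by [].
case: (PQ (x + y)) => [Pxy|Qxy].
  by case: nPx; apply: (PD y) => //; rewrite addrC.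
by case: nQy; apply: (QD x).
Qed.

Section JordanHomomorphism.
Variables (A B : pzRingType) (f : A -> B).
Hypothesis fD : {morph f : x y / x + y}.
Hypothesis fJ :
  forall a c, f (a * c + c * a) = f a * f c + f c * f a.
Hypothesis B_torsion : two_torsion_free B.

Lemma torsion_free_inj (x y : B) : x + x = y + y -> x = y.
Proof.
move=> xy; apply/eqP; rewrite -subr_eq0; apply/eqP/B_torsion.
by rewrite addrACA xy -opprD subrr.
Qed.

Lemma jordan_sqr a : f (a * a) = f a * f a.
Proof. by apply: torsion_free_inj; rewrite -fD fJ. Qed.

(** [2aba] is a combination of the Jordan products of [a] with [ab + ba] and of
    [aa] with [b]. *)
Lemma jordan_triple a b : f (a * b * a) = f a * f b * f a.
Proof.
apply: torsion_free_inj.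
have := fJ a (a * b + b * a).
rewrite jordan_triple_expand 2!fD !fJ jordan_sqr jordan_triple_expand.
exact: addIr.
Qed.

(** Linearisation of [jordan_triple] in [a]. *)
Lemma jordan_triple_sym a b c :
  f (a * b * c + c * b * a) = f a * f b * f c + f c * f b * f a.
Proof.
have := jordan_triple (a + c) b.
rewrite jordan_triple_polar 2!fD !jordan_triple [f (a + c)]fD.
by rewrite jordan_triple_polar => /addrI.
Qed.

Hypothesis f_surj : forall y, exists x, f x = y.
Hypothesis B_prime : prime_ring B.

(** The two evaluations of [abcba + bacab] are [a(bcb)a + b(aca)b] and
    [(ab)c(ba) + (ba)c(ab)]. *)
Lemma jordan_mul_or_antimul a b :
  f (a * b) = f a * f b \/ f (a * b) = f b * f a.
Proof.
suff: f (a * b) - f a * f b = 0 \/ f (a * b) - f b * f a = 0.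
  by case=> /subr0_eq ->; [left | right].
apply: prime_anticomm_eq0 => // y; have [c <-] := f_surj y.
have fba : f (b * a) = f a * f b + f b * f a - f (a * b).
  by rewrite -fJ fD addrC addKr.
rewrite mul_sub_sub_anticomm -fba -jordan_triple_sym -!jordan_triple -fD.
by rewrite !mulrA subrr.
Qed.

Theorem jordan_hom_or_antihom :
  (forall a b, f (a * b) = f a * f b) \/ (forall a b, f (a * b) = f b * f a).
Proof.
apply: additive_cover => [a c fa fac b|a c fa fac b|a].
- by move: (fac b); rewrite mulrDl !fD mulrDl fa => /addrI.
- by move: (fac b); rewrite mulrDl !fD mulrDr fa => /addrI.
apply: additive_cover => [b c fb fbc|b c fb fbc|b].
- by move: fbc; rewrite mulrDr !fD mulrDr fb => /addrI.
- by move: fbc; rewrite mulrDr !fD mulrDl fb => /addrI.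
exact: jordan_mul_or_antimul.
Qed.

End JordanHomomorphism.

(** * Peirce corners *)

Section Peirce.
Variables (K : fieldType) (A : algType K) (e : A).
Hypothesis e_idem : e * e = e.
Hypothesis e_neq0 : e <> 0.
Hypothesis e_neq1 : e <> 1.
Hypothesis A_prime : prime_ring A.

(** The Peirce idempotents [e] and [1 - e] are indexed by booleans, so that
    exchanging them is negation of the index and each lemma below covers both
    the statement for [e] and its mirror image. *)
Definition pe (i : bool) : A := if i then e else 1 - e.

Definition corner (i j : bool) (x : A) : Prop := pe i * x = x /\ x * pe j = x.

Lemma pe_idem i : pe i * pe i = pe i.
Proof.
case: i => //=; rewrite mulrBl mul1r mulrBr mulr1 e_idem subrr.
by rewrite subr0.
Qed.

Lemma pe_mul0 i j : i != j -> pe i * pe j = 0.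
Proof.
by case: i j => [] [] //= _; rewrite ?mulrBr ?mulrBl ?mulr1 ?mul1r e_idem subrr.
Qed.

Lemma peD i : pe i + pe (~~ i) = 1.
Proof. by case: i => /=; rewrite ?subrK // addrC subrK. Qed.

Lemma pe_neq0 i : pe i <> 0.
Proof. by case: i => //= /subr0_eq e1; apply: e_neq1. Qed.

Lemma corner_pe i : corner i i (pe i).
Proof. by split; rewrite pe_idem. Qed.

Lemma corner_cut i j x : corner i j (pe i * x * pe j).
Proof. by split; rewrite ?mulrA ?pe_idem // -mulrA pe_idem. Qed.

Lemma cornerZ k i j x : corner i j x -> corner i j (k *: x).
Proof. by case=> ix xj; split; rewrite -?scalerAr -?scalerAl ?ix ?xj. Qed.

Lemma cornerD i j x y : corner i j x -> corner i j y -> corner i j (x + y).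
Proof.
by case=> ix xj [iy yj]; split; rewrite ?mulrDr ?mulrDl ?ix ?xj ?iy ?yj.
Qed.

Lemma cornerM i j k l x y : corner i j x -> corner k l y -> corner i l (x * y).
Proof. by case=> ix xj [iy yj]; split; rewrite ?mulrA ?ix // -mulrA yj. Qed.

Lemma corner_mul0 i j k l x y :
  j != k -> corner i j x -> corner k l y -> x * y = 0.
Proof.
move=> jk [_ xj] [ky _].
by rewrite -xj -ky mulrA -(mulrA x) pe_mul0 // mulr0 mul0r.
Qed.

Lemma corner_of_mul0 i x :
  x * pe (~~ i) = 0 -> pe (~~ i) * x = 0 -> corner i i x.
Proof.
move=> xi ix; split.
  by rewrite -[RHS]mul1r -(peD i) mulrDl ix addr0.
by rewrite -[RHS]mulr1 -(peD i) mulrDr xi addr0.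
Qed.

Lemma corner_diag_eq0 i x : corner i i x -> corner (~~ i) (~~ i) x -> x = 0.
Proof.
by case=> ix _ [nix _]; rewrite -ix -nix mulrA pe_mul0 ?mul0r //; case: (i).
Qed.

Lemma peirce_decomp i x :
  x = pe i * x * pe i + (pe i * x * pe (~~ i) + pe (~~ i) * x * pe i)
      + pe (~~ i) * x * pe (~~ i).
Proof.
rewrite addrA -mulrDr peD mulr1 -addrA -mulrDr peD mulr1.
by rewrite -mulrDl peD mul1r.
Qed.

(** By primeness, since [x (pe i A pe (~~ i)) = 0] reads
    [x A pe (~~ i) = 0]. *)
Lemma corner_faithful_r i x :
  x * pe i = x -> (forall d, corner i (~~ i) d -> x * d = 0) -> x = 0.
Proof.
move=> xi x0; have [y|//|] := A_prime x (pe (~~ i)); last by move/pe_neq0.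
have -> : x * y * pe (~~ i) = x * (pe i * y * pe (~~ i)) by rewrite !mulrA xi.
by apply/x0/corner_cut.
Qed.

Lemma corner_faithful_l i x :
  pe i * x = x -> (forall d, corner (~~ i) i d -> d * x = 0) -> x = 0.
Proof.
move=> ix x0; have [y||//] := A_prime (pe (~~ i)) x; first last.
  by move/pe_neq0.
have -> : pe (~~ i) * y * x = pe (~~ i) * y * pe i * x.
  by rewrite -mulrA -mulrA ix mulrA.
by apply/x0/corner_cut.
Qed.

Hypothesis A_torsion : two_torsion_free A.

(** Multiplying [xe + ex = 0] by [e] on both sides gives [2exe = 0]; then
    multiplying it on one side gives [xe = 0] and [ex = 0]. *)
Lemma anticomm_idem_mul0 i x :
  x * pe i + pe i * x = 0 -> x * pe i = 0 /\ pe i * x = 0.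
Proof.
move=> xi0.
have ixi : pe i * x * pe i = 0.
  apply: A_torsion; have := congr1 ( *%R (pe i)) xi0.
  move/(congr1 ( *%R^~ (pe i))); rewrite mulr0 mul0r mulrDr mulrDl.
  by rewrite !mulrA pe_idem -(mulrA _ (pe i) (pe i)) pe_idem.
split.
  have := congr1 ( *%R^~ (pe i)) xi0.
  by rewrite mulrDl -(mulrA x) pe_idem ixi addr0 mul0r.
have := congr1 ( *%R (pe i)) xi0.
by rewrite mulrDr !mulrA pe_idem ixi add0r mulr0.
Qed.

(** * Additivity of maps compatible with a twisted Jordan product *)

Variables beta gamma : K.
Hypothesis beta_neq0 : beta != 0.
Hypothesis sum_neq0 : beta + gamma != 0.

Definition tw (x z : A) : A := beta *: (x * z) + gamma *: (z * x).

Lemma twDl x y z : tw (x + y) z = tw x z + tw y z.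
Proof. by rewrite /tw mulrDl mulrDr !scalerDr addrACA. Qed.

Lemma twDr x y z : tw z (x + y) = tw z x + tw z y.
Proof. by rewrite /tw mulrDl mulrDr !scalerDr addrACA. Qed.

Lemma twBl x y z : tw (x - y) z = tw x z - tw y z.
Proof. by rewrite twDl /tw mulNr mulrN !scalerN -opprD. Qed.

Lemma twBr x y z : tw z (x - y) = tw z x - tw z y.
Proof. by rewrite twDr /tw mulNr mulrN !scalerN -opprD. Qed.

Lemma tw_eq0 x z : x * z = 0 -> z * x = 0 -> tw x z = 0.
Proof. by rewrite /tw => -> ->; rewrite !scaler0 addr0. Qed.

Lemma tw_l x z : z * x = 0 -> tw x z = beta *: (x * z).
Proof. by rewrite /tw => ->; rewrite scaler0 addr0. Qed.

Lemma scale_eq0 k (x : A) : k != 0 -> k *: x = 0 -> x = 0.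
Proof. by move=> k0 /eqP; rewrite scaler_eq0 (negPf k0) => /eqP. Qed.

(** The two products add up to [(beta + gamma) (xz + zx)]. *)
Lemma tw_anticomm x z : tw x z = 0 -> tw z x = 0 -> x * z + z * x = 0.
Proof.
move=> xz zx; apply: (scale_eq0 (beta + gamma)) => //.
rewrite scalerDr !scalerDl [X in _ + X]addrC addrACA -/(tw x z) xz add0r.
by rewrite addrC.
Qed.

Variables (B : zmodType) (Phi : A -> B) (F : B -> B -> B).
Hypothesis Phi_bij : bijective Phi.
Hypothesis FDl : forall u v w, F (u + v) w = F u w + F v w.
Hypothesis FDr : forall u v w, F w (u + v) = F w u + F w v.
Hypothesis Phi_tw : forall x z, Phi (tw x z) = F (Phi x) (Phi z).

Definition adds (x y : A) : Prop := Phi (x + y) = Phi x + Phi y.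

(** An element [t] as in [sums t x y] always exists because [Phi] is onto;
    unlike [adds], the relation is inherited by products with any [z], as
    [sums_l] and [sums_r] say. *)
Definition sums (t x y : A) : Prop := Phi t = Phi x + Phi y.

Lemma Phi0 : Phi 0 = 0.
Proof.
have [Psi _ PsiK] := Phi_bij.
have F0 w : F 0 w = 0.
  by apply: (addrI (F 0 w)); rewrite -FDl !addr0.
by rewrite -(tw_eq0 (Psi 0) 0) ?mulr0 ?mul0r // Phi_tw PsiK F0.
Qed.

Lemma addsC x y : adds x y -> adds y x.
Proof. by rewrite /adds addrC [X in _ = X]addrC. Qed.

Lemma adds0r x : adds x 0.
Proof. by rewrite /adds Phi0 !addr0. Qed.

Lemma adds0l x : adds 0 x.
Proof. exact/addsC/adds0r. Qed.

Lemma adds_of_defect x y :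
  (forall t, sums t x y -> t - (x + y) = 0) -> adds x y.
Proof.
have [Psi _ PsiK] := Phi_bij.
move=> /(_ (Psi (Phi x + Phi y))); rewrite /sums PsiK => /(_ erefl) /subr0_eq.
by rewrite /adds => <-; rewrite PsiK.
Qed.

Lemma sums_adds t x y : sums t x y -> adds x y -> t = x + y.
Proof. by move=> txy xy; apply: (bij_inj Phi_bij); rewrite txy xy. Qed.

Lemma sums_l t x y z : sums t x y -> sums (tw t z) (tw x z) (tw y z).
Proof. by rewrite /sums !Phi_tw => ->. Qed.

Lemma sums_r t x y z : sums t x y -> sums (tw z t) (tw z x) (tw z y).
Proof. by rewrite /sums !Phi_tw => ->. Qed.

Lemma defect_l t x y z :
  sums t x y -> adds (tw x z) (tw y z) -> tw (t - (x + y)) z = 0.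
Proof.
move=> /(sums_l _ _ _ z) /sums_adds h /h tz.
by rewrite twBl tz twDl subrr.
Qed.

Lemma defect_r t x y z :
  sums t x y -> adds (tw z x) (tw z y) -> tw z (t - (x + y)) = 0.
Proof.
move=> /(sums_r _ _ _ z) /sums_adds h /h tz.
by rewrite twBr tz twDr subrr.
Qed.

(** The idempotent [pe (~~ i)] annihilates [x], so additivity on the products
    with it is trivial, and the defect anticommutes with it. *)
Lemma defect_corner i t x y :
  corner i i x -> sums t x y -> corner i i (t - (x + y)).
Proof.
move=> xi txy; have ni : ~~ i != i by case: (i).
have in_ : i != ~~ i by case: (i).
have xn : x * pe (~~ i) = 0.
  by apply: corner_mul0 xi (corner_pe _).
have nx : pe (~~ i) * x = 0.
  by apply: corner_mul0 (corner_pe _) xi.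
suff /anticomm_idem_mul0[dn nd] :
    (t - (x + y)) * pe (~~ i) + pe (~~ i) * (t - (x + y)) = 0.
  exact: corner_of_mul0.
apply: tw_anticomm.
  by apply: defect_l; rewrite // (tw_eq0 x); [exact: adds0l|..].
by apply: defect_r; rewrite // (tw_eq0 _ x); [exact: adds0l|..].
Qed.

(** For [d] in the same off-diagonal corner as [b], the products of [b] and [d]
    vanish, so the defect, which lies in the corner of [a], annihilates this
    [d]. *)
Lemma adds_diag_row i a b : corner i i a -> corner i (~~ i) b -> adds a b.
Proof.
move=> ai bi; apply: adds_of_defect => t tab.
have ni : ~~ i != i by case: (i).
have Di := defect_corner _ _ _ _ ai tab.
apply: (corner_faithful_r i) Di.2 _ => d di.
apply: (scale_eq0 beta) => //; rewrite -tw_l; last exact: corner_mul0 di Di.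
apply: defect_l => //; rewrite (tw_eq0 b); first exact: adds0r.
  exact: corner_mul0 bi di.
exact: corner_mul0 di bi.
Qed.

Lemma adds_diag_col i a b : corner i i a -> corner (~~ i) i b -> adds a b.
Proof.
move=> ai bi; apply: adds_of_defect => t tab.
have ni : i != ~~ i by case: (i).
have Di := defect_corner _ _ _ _ ai tab.
apply: (corner_faithful_l i) Di.1 _ => d di.
apply: (scale_eq0 beta) => //; rewrite -tw_l; last exact: corner_mul0 Di di.
apply: defect_r => //; rewrite (tw_eq0 _ b); first exact: adds0r.
  exact: corner_mul0 di bi.
exact: corner_mul0 bi di.
Qed.

(** An off-diagonal [d] is annihilated by [a] or by [b], hence anticommutes with
    the defect [D].  When [beta] and [gamma] differ, the vanishing of both
    products gives more, namely [Dd = 0].  When they agree, an element such as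
    [e - f] in a ring of 2 by 2 matrices, [f = 1 - e], anticommutes with every
    off-diagonal [d]; the diagonal part of [D] is then excluded by the product
    with [e / beta], which fixes [a] and [b] and therefore fixes [t]. *)
Lemma adds_offdiag i a b :
  corner i (~~ i) a -> corner (~~ i) i b -> adds a b.
Proof.
move=> ai bi; apply: adds_of_defect => t tab.
set D := t - (a + b).
have Dtw j d : corner j (~~ j) d -> tw D d = 0 /\ tw d D = 0.
  move=> dj.
  have [[ad da]|[bd db]] : (a * d = 0 /\ d * a = 0) \/ (b * d = 0 /\ d * b = 0).
  - case: i j ai bi dj => [] [] /= ai bi dj; [left|right|right|left];
      by split; [apply: corner_mul0 dj|apply: corner_mul0 dj _]; eauto.
  - split; [apply: defect_l|apply: defect_r] => //;
      by rewrite ?(tw_eq0 a d) ?(tw_eq0 d a) //; apply: adds0l.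
  - split; [apply: defect_l|apply: defect_r] => //;
      by rewrite ?(tw_eq0 b d) ?(tw_eq0 d b) //; apply: adds0r.
have Danti j d : corner j (~~ j) d -> D * d + d * D = 0.
  by move=> /Dtw[Dd dD]; apply: tw_anticomm.
have [bg|bg] := eqVneq beta gamma; last first.
  (* Twisted products: beta Dd + gamma dD = 0 together with dD = - Dd. *)
  have Dr j : D * pe j = 0.
    apply: (corner_faithful_r j); first by rewrite -mulrA pe_idem.
    move=> d dj; rewrite -mulrA dj.1; apply: (scale_eq0 (beta - gamma)).
      by rewrite subr_eq0.
    have dD : d * D = - (D * d).
      by apply/eqP; rewrite -addr_eq0 addrC (Danti j).
    by have [<- _] := Dtw _ _ dj; rewrite /tw dD scalerN scalerBl.
  by rewrite -[D]mulr1 -(peD i) mulrDr !Dr addr0.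
have off j : pe (~~ j) * D * pe j = 0.
  apply: (corner_faithful_r j); first by rewrite -!mulrA pe_idem.
  move=> d dj; rewrite -2!mulrA dj.1.
  have <- : pe (~~ j) * (D * d + d * D) = pe (~~ j) * (D * d).
    rewrite mulrDr [X in _ + X]mulrA -{2}dj.1 !mulrA pe_mul0 ?mul0r ?addr0 //.
    by case: (j).
  by rewrite (Danti j) // mulr0.
(* Now beta = gamma, and dividing pe i by beta turns its twisted product into
   the plain Jordan product. *)
have twe x : tw x (beta^-1 *: pe i) = x * pe i + pe i * x.
  by rewrite /tw -bg -scalerAr -scalerAl !scalerA mulfV // !scale1r.
have in_ : i != ~~ i by case: (i).
have ni : ~~ i != i by case: (i).
have ae : a * pe i = 0 by apply: corner_mul0 ai (corner_pe i).
have eb : pe i * b = 0 by apply: corner_mul0 (corner_pe i) bi.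
have t_fix : t * pe i + pe i * t = t.
  rewrite -twe; apply: (bij_inj Phi_bij).
  by rewrite (sums_l _ _ _ _ tab) !twe ae eb ai.1 bi.2 add0r addr0 -tab.
have D_fix : D * pe i + pe i * D = D.
  rewrite /D mulrBr mulrBl addrACA -opprD t_fix mulrDr mulrDl.
  by rewrite ae eb ai.1 bi.2 add0r addr0 [b + a]addrC.
have iDi : pe i * D * pe i = 0.
  have := congr1 (fun x => pe i * x * pe i) D_fix.
  rewrite mulrDr mulrDl !mulrA pe_idem -(mulrA _ (pe i) (pe i)) pe_idem.
  by rewrite -[RHS]add0r => /addIr.
have offi : pe i * D * pe (~~ i) = 0 by have := off (~~ i); rewrite negbK.
have Di0 : D * pe i = 0.
  by rewrite -[D]mul1r -(peD i) !mulrDl iDi off addr0.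
have iD0 : pe i * D = 0.
  by rewrite -[pe i * D]mulr1 -(peD i) mulrDr iDi offi addr0.
by rewrite -D_fix Di0 iD0 addr0.
Qed.

(** Multiplying by an off-diagonal [d] makes two diagonal terms out of [c]; a
    further multiplication by the idempotent [pe i] leaves only one of them, and
    then [adds_diag_row] applies. *)
Lemma adds_diag_offdiag i a b c :
  corner i i a -> corner i (~~ i) b -> corner (~~ i) i c -> adds a (b + c).
Proof.
move=> ai bi ci; apply: adds_of_defect => t tabc.
have ni : ~~ i != i by case: (i).
have in_ : i != ~~ i by case: (i).
have Di := defect_corner _ _ _ _ ai tabc.
apply: (corner_faithful_r i) Di.2 _ => d di.
have tw_pe x : corner i (~~ i) x -> tw (pe i) x = beta *: x.
  by move=> xi; rewrite tw_l ?xi.1 //; apply: corner_mul0 xi (corner_pe i).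
have twd x : corner i i x -> tw x d = beta *: (x * d).
  by move=> xi; apply: tw_l; apply: corner_mul0 di xi.
have twd_corner x : corner i i x -> corner i (~~ i) (tw x d).
  by move=> xi; rewrite twd //; apply: cornerZ; apply: cornerM xi di.
have twbc : corner i i (tw (pe i) (tw (b + c) d)).
  rewrite twDl (tw_eq0 b) ?add0r; last 2 first.
  - exact: corner_mul0 bi di.
  - exact: corner_mul0 di bi.
  have cd : corner (~~ i) (~~ i) (c * d) := cornerM _ _ _ _ _ _ ci di.
  have dc : corner i i (d * c) := cornerM _ _ _ _ _ _ di ci.
  rewrite /tw !(mulrDl, mulrDr) -!scalerAl -!scalerAr.
  rewrite (corner_mul0 _ _ _ _ _ _ in_ (corner_pe i) cd).
  rewrite (corner_mul0 _ _ _ _ _ _ ni cd (corner_pe i)).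
  by rewrite !scaler0 !add0r dc.1 dc.2; apply: cornerD; do 2! apply: cornerZ.
have twa : corner i (~~ i) (tw (pe i) (tw a d)).
  by rewrite tw_pe; [apply: cornerZ|]; apply: twd_corner.
have := sums_adds _ _ _ (sums_r _ _ _ (pe i) (sums_l _ _ _ d tabc))
  (addsC _ _ (adds_diag_row i _ _ twbc twa)).
rewrite -twDr -twDl => /eqP; rewrite -subr_eq0 -twBr -twBl => /eqP.
rewrite tw_pe; last exact: twd_corner.
by rewrite twd // => /(scale_eq0 _ _ beta_neq0) /(scale_eq0 _ _ beta_neq0).
Qed.

(** The same [t] is compared with [a] on one side and with [d] on the other:
    the defect lies in two opposite diagonal corners, hence vanishes. *)
Lemma Phi_peirce i a b c d :
  corner i i a -> corner i (~~ i) b -> corner (~~ i) i c ->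
  corner (~~ i) (~~ i) d ->
  Phi (a + (b + c) + d) = Phi a + (Phi b + Phi c) + Phi d.
Proof.
move=> ai bi ci di.
have nni : ~~ ~~ i = i := negbK i.
have bc := adds_offdiag i _ _ bi ci.
have abc := adds_diag_offdiag i _ _ _ ai bi ci.
have dcb : adds d (b + c).
  by rewrite [b + c]addrC; apply: (adds_diag_offdiag (~~ i)); rewrite ?nni.
rewrite -bc -abc; apply: addsC; apply: adds_of_defect => t tabcd.
have D1 := defect_corner _ _ _ _ di tabcd.
have t2 : sums t a (b + c + d).
  by rewrite /sums tabcd abc addrC -addrA [b + c + d]addrC dcb [Phi d + _]addrC.
have := defect_corner _ _ _ _ ai t2.
by rewrite addrA [_ + d]addrC => D2; apply: corner_diag_eq0 D2 D1.
Qed.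

(** With [f = pe (~~ i)], the twisted product of [pe i + a / beta] and
    [f + b / beta] is [a + b], while [Phi] is already additive on each of the
    two factors. *)
Lemma adds_row i a b : corner i (~~ i) a -> corner i (~~ i) b -> adds a b.
Proof.
move=> ai bi; pose n := ~~ i.
have in_ : i != n by rewrite /n; case: (i).
have ni : n != i by rewrite /n; case: (i).
have [a'i b'i] := (cornerZ beta^-1 _ _ _ ai, cornerZ beta^-1 _ _ _ bi).
set a' := beta^-1 *: a in a'i; set b' := beta^-1 *: b in b'i.
have h1 : adds (pe i) a' by apply: adds_diag_row a'i; apply: corner_pe.
have h2 : adds (pe n) b'.
  by apply: (adds_diag_col n); rewrite /n ?negbK //; apply: corner_pe.
have p1 : tw (pe i) (pe n) = 0 by apply: tw_eq0; apply: pe_mul0.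
have p2 : tw (pe i) b' = b.
  rewrite tw_l ?b'i.1 ?scalerA ?mulfV ?scale1r //.
  exact: corner_mul0 b'i (corner_pe i).
have p3 : tw a' (pe n) = a.
  rewrite tw_l ?a'i.2 ?scalerA ?mulfV ?scale1r //.
  exact: corner_mul0 (corner_pe n) a'i.
have p4 : tw a' b' = 0.
  by apply: tw_eq0; [apply: corner_mul0 a'i b'i|apply: corner_mul0 b'i a'i].
have ab : tw (pe i + a') (pe n + b') = a + b.
  by rewrite twDl !twDr p1 p2 p3 p4 add0r addr0 addrC.
rewrite /adds -{1}ab Phi_tw h1 h2 FDl !FDr -!Phi_tw p1 p2 p3 p4 Phi0.
by rewrite add0r addr0 addrC.
Qed.

(** Multiplication by an off-diagonal [d] moves both terms into one off-diagonal
    corner, where additivity is known. *)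
Lemma adds_diag i a b : corner i i a -> corner i i b -> adds a b.
Proof.
move=> ai bi; apply: adds_of_defect => t tab.
have ni : ~~ i != i by case: (i).
have Di := defect_corner _ _ _ _ ai tab.
apply: (corner_faithful_r i) Di.2 _ => d di.
have twd x : corner i i x -> tw x d = beta *: (x * d).
  by move=> xi; apply: tw_l; apply: corner_mul0 di xi.
apply: (scale_eq0 beta) => //; rewrite -twd //.
apply: defect_l => //; rewrite !twd //.
by apply: (adds_row i); apply: cornerZ;
  [apply: cornerM ai di|apply: cornerM bi di].
Qed.

Theorem twisted_jordan_additive x y : Phi (x + y) = Phi x + Phi y.
Proof.
have cut i j : Phi (pe i * (x + y) * pe j)
    = Phi (pe i * x * pe j) + Phi (pe i * y * pe j).
  rewrite mulrDr mulrDl; have [->|ij] := eqVneq i j.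
    by apply: (adds_diag j); apply: corner_cut.
  have -> : j = ~~ i by case: i j ij => [] [].
  by apply: (adds_row i); apply: corner_cut.
have PhiE z : Phi z = Phi (pe true * z * pe true)
    + (Phi (pe true * z * pe false) + Phi (pe false * z * pe true))
    + Phi (pe false * z * pe false).
  by rewrite {1}(peirce_decomp true z) (Phi_peirce true) //; apply: corner_cut.
rewrite (PhiE x) (PhiE y) (PhiE (x + y)) !cut; symmetry.
rewrite addrACA; congr (_ + _); rewrite addrACA; congr (_ + _).
exact: addrACA.
Qed.

End Peirce.

(** * The six-term triple product *)

Section TripleProduct.
Variables (K : fieldType) (a1 a2 a3 a4 a5 a6 : K).

(** The product of the theorem with [d] in the place of the adjoint of the
    second argument, which makes it trilinear. *)
Definition triple (A : algType K) (x d z : A) : A :=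
  a1 *: (x * d * z) + a2 *: (x * z * d) + a3 *: (d * x * z)
  + a4 *: (z * x * d) + a5 *: (d * z * x) + a6 *: (z * d * x).

Let beta := a1 + a2 + a3.
Let gamma := a4 + a5 + a6.

Section Identities.
Variable A : algType K.
Implicit Types x y d z : A.

Lemma tripleDl x y d z : triple A (x + y) d z = triple A x d z + triple A y d z.
Proof.
rewrite /triple !(mulrDl, mulrDr, scalerDr).
by rewrite [LHS](AC (2*2*2*2*2*2) ((1*3*5*7*9*11)*(2*4*6*8*10*12))).
Qed.

Lemma tripleDr x y d z : triple A z d (x + y) = triple A z d x + triple A z d y.
Proof.
rewrite /triple !(mulrDl, mulrDr, scalerDr).
by rewrite [LHS](AC (2*2*2*2*2*2) ((1*3*5*7*9*11)*(2*4*6*8*10*12))).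
Qed.

Lemma triple_mid1 x z : triple A x 1 z = tw K A beta gamma x z.
Proof.
by rewrite /triple /tw /beta /gamma !mulr1 !mul1r !scalerDl !addrA.
Qed.

Lemma triple_left1_right1 d : triple A 1 d 1 = (beta + gamma) *: d.
Proof.
by rewrite /triple /beta /gamma !mulr1 !mul1r !scalerDl !addrA.
Qed.

(** Each of the six monomials in [x], [q], [q] begins or ends with [q]. *)
Lemma triple_idem_compl q x :
  q * q = q -> (1 - q) * triple A x q q * (1 - q) = 0.
Proof.
move=> qq.
have ql y z : (1 - q) * (q * y * z) = 0.
  by rewrite !mulrA mulrBl mul1r qq subrr !mul0r.
have qr y : y * q * (1 - q) = 0.
  by rewrite -mulrA mulrBr mulr1 qq subrr mulr0.
move: (1 - q) ql qr => p ql qr.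
rewrite /triple !mulrDr -!scalerAr !ql !scaler0 !addr0.
by rewrite mulrDl -!scalerAl !mulrA !qr !scaler0 !addr0.
Qed.

End Identities.
End TripleProduct.

Lemma num_alg_two_torsion_free (K : numFieldType) (A : algType K) :
  two_torsion_free A.
Proof.
move=> x; rewrite -mulr2n -scaler_nat => /scale_eq0; apply.
by rewrite Num.Theory.pnatr_eq0.
Qed.

Lemma star1 (R : realType) (A : starAlgType R) : star (1 : A) = 1.
Proof.
have := starM (star (1 : A)) 1.
by rewrite mulr1 starK mulr1 => <-.
Qed.

Theorem theorem2p1 (R : realType)
    (alpha1 alpha2 alpha3 alpha4 alpha5 alpha6 : R[i])
    (alpha_neq0 : alpha1 + alpha2 + alpha3 + alpha4 + alpha5 + alpha6 <> 0)
    (A B : starAlgType R)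
    (A_prime : prime_algebra A)
    (A_proj : exists p : A, nontrivial_projection p)
    (Phi : A -> B)
    (Phi_bij : bijective Phi)
    (Phi_triple : forall a b c : A,
       Phi (alpha1 *: (a * star b * c) + alpha2 *: (a * c * star b)
            + alpha3 *: (star b * a * c) + alpha4 *: (c * a * star b)
            + alpha5 *: (star b * c * a) + alpha6 *: (c * star b * a))
       = alpha1 *: (Phi a * star (Phi b) * Phi c)
         + alpha2 *: (Phi a * Phi c * star (Phi b))
         + alpha3 *: (star (Phi b) * Phi a * Phi c)
         + alpha4 *: (Phi c * Phi a * star (Phi b))
         + alpha5 *: (star (Phi b) * Phi c * Phi a)
         + alpha6 *: (Phi c * star (Phi b) * Phi a)) :
  [/\ additive_map Phi,
      projection (Phi 1) -> star_jordan_ring_isomorphism Phi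
    & prime_algebra B -> projection (Phi 1) ->
      star_ring_isomorphism Phi \/ star_ring_anti_isomorphism Phi].
Proof.
set beta := alpha1 + alpha2 + alpha3; set gamma := alpha4 + alpha5 + alpha6.
pose T (X : starAlgType R) : X -> X -> X -> X :=
  triple _ alpha1 alpha2 alpha3 alpha4 alpha5 alpha6 X.
have s_neq0 : beta + gamma != 0.
  by apply/eqP; rewrite /beta /gamma !addrA.
have PhiT a b c : Phi (T A a (star b) c) = T B (Phi a) (star (Phi b)) (Phi c).
  exact: Phi_triple.
pose F u v := T B u (star (Phi 1)) v.
have PhiF a c : Phi (tw _ A beta gamma a c) = F (Phi a) (Phi c).
  by rewrite -triple_mid1 -star1; apply: PhiT.
have FDl u v w : F (u + v) w = F u w + F v w by apply: tripleDl.
have FDr u v w : F w (u + v) = F w u + F w v by apply: tripleDr.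
have Phi_additive : additive_map Phi.
  case: A_proj => p [[_ pp] p0 p1]; rewrite expr2 in pp.
  have At := num_alg_two_torsion_free _ A.
  (* If beta = 0, exchange the factors: gamma then takes its place. *)
  have [b0|b0] := eqVneq beta 0.
    pose G u v := F v u.
    have g0 : gamma != 0 by move: s_neq0; rewrite b0 add0r.
    have g_sum : gamma + beta != 0 by rewrite addrC.
    apply: (twisted_jordan_additive _ A p _ p0 p1 A_prime At gamma beta g0 g_sum
      B Phi G) => // a c.
    by rewrite /G -PhiF /tw addrC.
  exact: (twisted_jordan_additive _ A p _ p0 p1 A_prime At beta gamma b0 s_neq0
    B Phi F).
have Jordan : projection (Phi 1) -> star_jordan_ring_isomorphism Phi.
  case=> q_star q_idem; rewrite expr2 in q_idem.
  have [Psi _ PsiK] := Phi_bij.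
  (* The argument (beta + gamma)^-1 Psi 1 is chosen so that the triple product
     of its image with Phi 1, Phi 1 equals 1; compressing by 1 - Phi 1 then
     gives 1 - Phi 1 = 0. *)
  have Phi1 : Phi 1 = 1.
    apply/esym/subr0_eq.
    have := triple_idem_compl _ alpha1 alpha2 alpha3 alpha4 alpha5 alpha6 B
      (Phi 1) (Phi ((beta + gamma)^-1 *: Psi 1)) (esym q_idem).
    have -> : triple _ alpha1 alpha2 alpha3 alpha4 alpha5 alpha6 B
      (Phi ((beta + gamma)^-1 *: Psi 1)) (Phi 1) (Phi 1) = 1.
      rewrite {1}q_star -[LHS]/(F _ _) -PhiF /tw mulr1 mul1r -scalerDl.
      by rewrite scalerA mulfV // scale1r PsiK.
    rewrite mulr1 mulrBr mulr1 mulrBl mul1r -q_idem subrr subr0.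
    exact.
  have PhiZ a : Phi ((beta + gamma) *: a) = (beta + gamma) *: Phi a.
    have := PhiF a 1.
    by rewrite /F /T Phi1 star1 triple_mid1 /tw !mulr1 !mul1r -!scalerDl.
  have Phi_star : star_preserving Phi.
    move=> b; have := PhiT 1 b 1.
    by rewrite Phi1 /T !triple_left1_right1 PhiZ; apply: scalerI.
  split=> // a c; apply: (scalerI s_neq0); rewrite -PhiZ.
  have twC (X : algType R[i]) (x z : X) : tw _ X beta gamma x z
      + tw _ X beta gamma z x = (beta + gamma) *: (x * z + z * x).
    rewrite /tw [X in _ + X]addrC addrACA -!scalerDl scalerDr.
    by rewrite [gamma + _]addrC.
  by rewrite -!twC Phi_additive !PhiF /F /T Phi1 star1 !triple_mid1.
split=> // B_prime /Jordan[_ _ PhiJ Phi_star].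
have [Psi _ PsiK] := Phi_bij.
have Bt := num_alg_two_torsion_free _ B.
have surj y : exists x, Phi x = y by exists (Psi y).
have [PhiM|PhiM] :=
  jordan_hom_or_antihom A B Phi Phi_additive PhiJ Bt surj B_prime.
- by left.
- by right.
Qed.
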